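(* Let $t\in[n]$. If $P$ is a prime ideal of $R$ minimal over $\mathcal{I}^{\langle t\rangle}$, then $P=P^{\langle t\rangle}_S$ for some maximal $t$-switchable set $S\subseteq N$.
   Context: Fix positive integers $n, r_1,\dots,r_n$, let $N=[r_1]\times\cdots\times[r_n]$, and let $R$ be the polynomial ring over a field in the variables $x_a$, $a\in N$. For $a,b\in N$ and $i\in[n]$, ${\rm s}(i,a,b)\in N$ has $i$-th component $b_i$ and other components equal to those of $a$. Let $d(a,b)=\#\{j: a_j\neq b_j\}$ and $f_{i,a,b}=x_ax_b-x_{{\rm s}(i,a,b)}x_{{\rm s}(i,b,a)}$. Let $\mathcal{I}^{\langle t\rangle}=(f_{i,a,b}: a,b\in N,\ d(a,b)=2,\ i\in[t])$. A subset $S\subseteq N$ is $t$-switchable if for all $a,b\in S$ with $d(a,b)=2$ and all $i\in[t]$, ${\rm s}(i,a,b)\in S$. Elements $a,b\in S$ are connected in $S$ if there are $a_0=a,\dots,a_k=b$ in $S$ with $d(a_{j-1},a_j)\le 1$ for all $j$. For $t$-switchable $S$: $\tilde{\mathcal{I}}^{\langle t\rangle}_S=(f_{i,a,b}: i\in[t],\ a,b \text{ connected in } S)$, $\mathrm{Var}^{\langle t\rangle}_S=(x_a: a\notin S)$, $P^{\langle t\rangle}_S=\mathrm{Var}^{\langle t\rangle}_S+\tilde{\mathcal{I}}^{\langle t\rangle}_S$. A $t$-switchable $S$ is maximal $t$-switchable if for every $t$-switchable $T$ properly containing $S$, $P^{\langle t\rangle}_S$ and $P^{\langle t\rangle}_T$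 are incomparable under inclusion. *)

(* Defs.v *)
From HB Require Import structures.
From mathcomp Require Import all_boot all_order all_algebra.
From mathcomp Require Import mpoly.
Set Implicit Arguments. Unset Strict Implicit. Unset Printing Implicit Defensive.
Import GRing.Theory.
Local Open Scope ring_scope.

Section Ideals.
Variable R : comNzRingType.

Definition is_ideal (I : R -> Prop) : Prop :=
  [/\ I 0, (forall x y, I x -> I y -> I (x + y)) & (forall r x, I x -> I (r * x))].

Definition ideal_gen (G : R -> Prop) : R -> Prop :=
  fun x => forall J, is_ideal J -> (forall g, G g -> J g) -> J x.

Definition ideal_add (I J : R -> Prop) : R -> Prop :=
  ideal_gen (fun x => I x \/ J x).

Definition subideal (I J : R -> Prop) : Prop := forall x, I x -> J x.

Definition is_prime_ideal (P : R -> Prop) : Prop :=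
  [/\ is_ideal P, ~ P 1 & forall a b, P (a * b) -> P a \/ P b].

Definition minimal_prime_over (I P : R -> Prop) : Prop :=
  [/\ is_prime_ideal P, subideal I P &
      forall Q, is_prime_ideal Q -> subideal I Q -> subideal Q P -> subideal P Q].
End Ideals.

Section Setting.
Variables (n : nat) (r : 'I_n -> nat).

Definition N := {dffun forall i : 'I_n, 'I_(r i)}.

Definition sw (i : 'I_n) (a b : N) : N :=
  [ffun j => if j == i then b j else a j].

Definition dist (a b : N) : nat := #|[set j | a j != b j]|.

Variable F : fieldType.

Definition PR := {mpoly F[#|{: N}|]}.
Definition xv (a : N) : PR := 'X_(enum_rank a).

Definition fpol (i : 'I_n) (a b : N) : PR :=
  xv a * xv b - xv (sw i a b) * xv (sw i b a).

(* coordinates i in [t] are the first t coordinates, i.e. (i < t)%N with 0-based 'I_n *)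
Definition Igen (t : nat) : PR -> Prop :=
  ideal_gen (fun f => exists (i : 'I_n) (a b : N),
                 dist a b = 2%N /\ (i < t)%N /\ f = fpol i a b).

Definition switchable (t : nat) (S : {set N}) : Prop :=
  forall a b, a \in S -> b \in S -> dist a b = 2%N ->
  forall i : 'I_n, (i < t)%N -> sw i a b \in S.

Definition connected_in (S : {set N}) (a b : N) : Prop :=
  a \in S /\ exists p : seq N,
    [/\ path (fun x y => (dist x y <= 1)%N) a p, last a p = b & all (mem S) p].

Definition Itilde (t : nat) (S : {set N}) : PR -> Prop :=
  ideal_gen (fun f => exists (i : 'I_n) (a b : N),
                 [/\ (i < t)%N, connected_in S a b & f = fpol i a b]).

Definition VarS (S : {set N}) : PR -> Prop :=
  ideal_gen (fun f => exists a : N, a \notin S /\ f = xv a).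

Definition PS (t : nat) (S : {set N}) : PR -> Prop :=
  ideal_add (VarS S) (Itilde t S).

Definition max_switchable (t : nat) (S : {set N}) : Prop :=
  switchable t S /\
  forall T : {set N}, switchable t T -> S \proper T ->
    ~ subideal (PS t S) (PS t T) /\ ~ subideal (PS t T) (PS t S).
End Setting.

(* Main.v *)
(* Let S be the set of the a with x_a not in P. The quadratic relations make S
   t-switchable, and cancelling the nonzero x_a, a in S, modulo P propagates them
   along paths, so P contains P_S. Modulo the variables outside S, a component of
   S is a product C_1 x ... x C_t x D, and P_S is the kernel of the Segre monomial
   map sending x_a to the product of one variable for each factor; hence P_S is
   prime. Minimality gives P = P_S, and also that no P_T with T a larger
   t-switchable set lies in P_S, while P_S contains x_a, not in P_T, for a in T
   outside S. *)
Require Import Defs.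
From HB Require Import structures.
From mathcomp Require Import all_boot all_order all_algebra.
From mathcomp Require Import mpoly ring.
From Stdlib Require Import ClassicalEpsilon.

Set Implicit Arguments. Unset Strict Implicit. Unset Printing Implicit Defensive.
Import GRing.Theory.
Local Open Scope ring_scope.

(** * Ideals, congruences modulo an ideal, and kernels as primes *)

Section Ideals.
Variable R : comNzRingType.
Implicit Types (I J G : R -> Prop).

Lemma ideal_gen_is_ideal G : is_ideal (ideal_gen G).
Proof.
split=> [J [] //|x y Gx Gy J idJ GJ|a x Gx J idJ GJ];
  have [_ JD JM] := idJ.
  exact: JD (Gx J idJ GJ) (Gy J idJ GJ).
exact: JM (Gx J idJ GJ).
Qed.

Lemma mem_ideal_gen G x : G x -> ideal_gen G x.
Proof. by move=> Gx J _; apply. Qed.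

Variables (I : R -> Prop) (idI : is_ideal I).

Lemma ideal0 : I 0. Proof. by case: idI. Qed.

Lemma idealD x y : I x -> I y -> I (x + y).
Proof. by case: idI => _ + _; apply. Qed.

Lemma idealMl a x : I x -> I (a * x).
Proof. by case: idI => _ _; apply. Qed.

Lemma idealN x : I x -> I (- x).
Proof. by move=> Ix; rewrite -mulN1r; apply: idealMl. Qed.

Lemma idealBC x y : I (x - y) -> I (y - x).
Proof. by move=> Ixy; rewrite -opprB; apply: idealN. Qed.

Lemma ideal_congr_trans y x z : I (x - y) -> I (y - z) -> I (x - z).
Proof. by move=> Ixy Iyz; rewrite -(subrKA y); apply: idealD. Qed.

Lemma ideal_congr_mull a x y : I (x - y) -> I (a * x - a * y).
Proof. by rewrite -mulrBr; apply: idealMl. Qed.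

Lemma ideal_sum (T : eqType) (s : seq T) (p : pred T) (f : T -> R) :
  (forall x, x \in s -> p x -> I (f x)) -> I (\sum_(x <- s | p x) f x).
Proof.
move=> If; rewrite big_seq_cond; elim/big_ind: _ => [|x y|x].
- exact: ideal0.
- exact: idealD.
- by case/andP; apply: If.
Qed.
End Ideals.

Lemma ker_prime_ideal (R : comNzRingType) (D : idomainType)
  (phi : {rmorphism R -> D}) : is_prime_ideal (fun x => phi x = 0).
Proof.
split; first split.
- exact: rmorph0.
- by move=> x y x0 y0; rewrite rmorphD x0 y0 addr0.
- by move=> a x x0; rewrite rmorphM x0 mulr0.
- by rewrite rmorph1 => /eqP; rewrite oner_eq0.
- move=> a b /eqP; rewrite rmorphM mulf_eq0.
  by case/orP => /eqP; [left | right].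
Qed.

Lemma sum_by_value (T U : eqType) (V : nmodType) (p : T -> U) (s : seq T)
    (G : T -> V) :
  \sum_(x <- s) G x =
  \sum_(v <- undup (map p s)) \sum_(x <- s | p x == v) G x.
Proof.
rewrite (exchange_big_dep xpredT) //=; apply: eq_big_seq => x xs.
rewrite -big_filter (eq_filter (a2 := pred1 (p x))).
  by rewrite filter_pred1_uniq ?undup_uniq ?mem_undup ?map_f // big_seq1.
by move=> v; rewrite /= eq_sym.
Qed.

Lemma mpolyX_eq0 (n : nat) (R : nzRingType) (m : 'X_{1..n}) :
  ('X_[m] == 0 :> {mpoly R[n]}) = false.
Proof.
apply/eqP=> /(congr1 (mcoeff m)) /eqP.
by rewrite mcoeffX mcoeff0 eqxx oner_eq0.
Qed.

(** * Combinatorics of switching and connectivity in [S] *)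

Section Switching.
Variables (n : nat) (r : 'I_n -> nat).
Implicit Types (a b c : N r) (i j k : 'I_n) (S T : {set N r}).

Lemma swE i a b j : sw i a b j = if j == i then b j else a j.
Proof. by rewrite ffunE. Qed.

Lemma sw_id i a : sw i a a = a.
Proof. by apply/ffunP=> j; rewrite swE if_same. Qed.

Lemma sw_swl i a b c : sw i (sw i a b) c = sw i a c.
Proof. by apply/ffunP=> j; rewrite !swE; case: eqP. Qed.

Lemma sw_swr i a b c : sw i a (sw i b c) = sw i a c.
Proof. by apply/ffunP=> j; rewrite !swE; case: eqP. Qed.

Lemma eq_swr i a b c : b i = c i -> sw i a b = sw i a c.
Proof. by move=> bc; apply/ffunP=> j; rewrite !swE; case: eqP => // ->. Qed.

Lemma sw_eql i a b : a i = b i -> sw i a b = a.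
Proof. by move=> ab; rewrite -(eq_swr a ab) sw_id. Qed.

Lemma distC a b : dist a b = dist b a.
Proof.
have e : [set j | a j != b j] = [set j | b j != a j].
  by apply/setP=> j; rewrite !inE eq_sym.
by rewrite /dist e.
Qed.

Lemma dist_le1_intro a b j : (forall k, k != j -> a k = b k) -> (dist a b <= 1)%N.
Proof.
move=> ab; rewrite -(cards1 j) /dist; apply/subset_leq_card/subsetP => k.
by rewrite !inE; apply: contraNT => /ab ->.
Qed.

Lemma dist_le1_elim i a b : (dist a b <= 1)%N ->
  exists j, forall k, k != j -> a k = b k.
Proof.
rewrite leq_eqVlt ltnS leqn0 => /orP[/cards1P[j ej]|/eqP/cards0_eq e0].
  exists j => k kj; apply/eqP; move/setP/(_ k): ej.
  by rewrite !inE (negPf kj) => /negbFE.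
by exists i => k _; apply/eqP; move/setP/(_ k): e0; rewrite !inE => /negbFE.
Qed.

Lemma dist_eq2 a b j k : j != k -> a j != b j -> a k != b k ->
  (forall l, l != j -> l != k -> a l = b l) -> dist a b = 2%N.
Proof.
move=> jk aj ak ab; suff e : [set l | a l != b l] = [set j; k].
  by rewrite /dist e cards2 jk.
apply/setP=> l; rewrite !inE.
have [->|lj] := eqVneq l j; first by rewrite aj.
have [->|lk] := eqVneq l k; first by rewrite ak.
by rewrite (ab l lj lk) eqxx.
Qed.

Lemma dist_swl i a b : (dist a (sw i a b) <= 1)%N.
Proof. by apply: (dist_le1_intro (j := i)) => k; rewrite swE => /negPf->. Qed.

Lemma dist_sw_le1 i a b : dist a b = 2%N -> a i != b i -> (dist (sw i a b) b <= 1)%N.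
Proof.
move=> ab2 abi; have := cardsD1 i [set j | a j != b j].
rewrite -/(dist a b) ab2 inE abi add1n => -[] /eqP; rewrite eq_sym => /eqP e1.
rewrite -[leqRHS]e1 /dist; apply/subset_leq_card/subsetP=> k.
by rewrite !inE swE; have [->|ki] := eqVneq k i; rewrite ?eqxx.
Qed.

Lemma dist_sw_sw i a b : dist (sw i a b) (sw i b a) = dist a b.
Proof.
suff e : [set j | sw i a b j != sw i b a j] = [set j | a j != b j].
  by rewrite /dist e.
by apply/setP=> j; rewrite !inE !swE; have [->|_] := eqVneq j i => //; rewrite eq_sym.
Qed.

(** Requiring both ends in [S] keeps paths inside [S]. Only the reflexive case of [connect] escapes,
    hence the separate hypotheses [a \in S] below. *)
Definition adj S a b := [&& a \in S, b \in S & (dist a b <= 1)%N].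

Lemma adj_connect_sym S : connect_sym (adj S).
Proof.
by apply: sym_connect_sym => a b; rewrite /adj distC andbCA.
Qed.

Lemma connected_inP S a b : connected_in S a b <-> a \in S /\ connect (adj S) a b.
Proof.
split=> [[aS [p [pa <- /allP pS]]]|[aS /connectP[p pa ->]]].
  split=> //; apply/connectP; exists p => //.
  elim: p a aS pa pS => //= c p IH a aS /andP[ac pc] pS.
  have cS : c \in S by apply: (pS c); rewrite mem_head.
  rewrite /adj aS cS ac; apply: IH => // d dp; apply: pS.
  by rewrite inE dp orbT.
split=> //; exists p; split=> //.
  by apply: sub_path pa => c d /and3P[].
elim: p a aS pa => //= c p IH a aS /andP[/and3P[_ cS _] /(IH c cS) ->].
by rewrite cS.
Qed.

Lemma adj_connect_ind S b (Q : N r -> Prop) : (b \in S -> Q b) ->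
  (forall a c, a \in S -> c \in S -> (dist a c <= 1)%N ->
     connect (adj S) c b -> Q c -> Q a) ->
  forall a, a \in S -> connect (adj S) a b -> Q a.
Proof.
move=> Qb Qstep a aS /connectP[p]; elim: p a aS => [|c p IH] a aS /=.
  by move=> _ e; move: aS Qb; rewrite e => aS; apply.
move=> /andP[/and3P[_ cS ac] pc] eb; apply: (Qstep a c) => //.
  by apply/connectP; exists p.
exact: IH.
Qed.

Lemma connect_mem S a b : a \in S -> connect (adj S) a b -> b \in S.
Proof. by move: a; apply: adj_connect_ind. Qed.

Variables (t : nat) (S : {set N r}).
Hypothesis swS : switchable t S.

(** Extends switchability from distance 2 to connected pairs, by induction along the path. If the
    next point [c] differs from [a] only at some [j != i], and [a i != b i], then [sw i c b] is in
    [S] by induction and differs from [a] exactly at [i] and [j]; switching [a] with it gives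
    [sw i a b]. *)
Lemma sw_mem i a b : (i < t)%N -> a \in S -> connect (adj S) a b -> sw i a b \in S.
Proof.
move=> it; move: a; apply: adj_connect_ind => [|a c aS cS ac _ IH].
  by rewrite sw_id.
have [ai|abi] := eqVneq (a i) (b i); first by rewrite sw_eql.
have [j acj] := dist_le1_elim i ac.
have [ji|ji] := eqVneq i j.
  have <- // : sw i c b = sw i a b.
  by apply/ffunP=> k; rewrite !swE; case: eqP => // /eqP ki; rewrite acj -?ji.
have [eqj|neqj] := eqVneq (a j) (c j).
  have -> // : a = c.
  by apply/ffunP=> k; have [->|/acj] := eqVneq k j.
have -> : sw i a b = sw i a (sw i c b) by rewrite sw_swr.
apply: swS => //; apply: (dist_eq2 (j := i) (k := j)) => //; rewrite ?swE ?eqxx //.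
  by rewrite [j == i]eq_sym (negPf ji).
by move=> l li lj; rewrite swE (negPf li) acj.
Qed.

Lemma sw_connect i a b : (i < t)%N -> a \in S -> connect (adj S) a b ->
  connect (adj S) a (sw i a b).
Proof.
move=> it aS ab; apply: connect1.
by rewrite /adj aS sw_mem // dist_swl.
Qed.

Lemma dist2_connect i a b : (i < t)%N -> a \in S -> b \in S -> dist a b = 2%N ->
  a i != b i -> connect (adj S) a b.
Proof.
move=> it aS bS ab2 abi; have sS : sw i a b \in S by apply: swS.
apply: (@connect_trans _ _ (sw i a b)); apply: connect1.
  by rewrite /adj aS sS dist_swl.
by rewrite /adj sS bS dist_sw_le1.
Qed.
End Switching.

(** * [PS] as the kernel of the Segre map *)

Section Toric.
Variables (n : nat) (r : 'I_n -> nat) (F : fieldType) (t : nat) (S : {set N r}).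
Hypothesis swS : switchable t S.
Implicit Types (a b c : N r) (i j k : 'I_n) (o : option 'I_n) (s : seq (N r)).

Local Notation xv := (@xv n r F).
Local Notation fpol := (@fpol n r F).
Local Notation PS := (@PS n r F t S).

Lemma PS_is_ideal : is_ideal PS.
Proof. exact: ideal_gen_is_ideal. Qed.

Lemma PS_var a : a \notin S -> PS (xv a).
Proof. by move=> aS; apply: mem_ideal_gen; left; apply: mem_ideal_gen; exists a. Qed.

Lemma PS_fpol i a b : (i < t)%N -> a \in S -> connect (adj S) a b -> PS (fpol i a b).
Proof.
move=> it aS ab; apply: mem_ideal_gen; right; apply: mem_ideal_gen.
by exists i, a, b; split=> //; apply/connected_inP.
Qed.

Lemma PS_sub (J : PR r F -> Prop) : is_ideal J -> (forall a, a \notin S -> J (xv a)) ->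
  (forall i a b, (i < t)%N -> a \in S -> connect (adj S) a b -> J (fpol i a b)) ->
  subideal PS J.
Proof.
move=> idJ Jvar Jf x; apply=> // g [] /(_ J idJ); apply=> h.
  by case=> a [aS ->]; apply: Jvar.
by case=> i [a [b [it /connected_inP[aS ab] ->]]]; apply: Jf.
Qed.

Definition comp_root a := fingraph.root (adj S) a.

(* The variables of the target of the Segre map: for each component, [Some i]
   stands for the factor of the [i]-th coordinate and [None] for the single factor
   formed by all coordinates from [t] on; values are completed to elements of [N]
   by the coordinates of the root of the component. *)
Definition proj o a : N r :=
  if o is Some i then sw i (comp_root a) a
  else finfun (fun j : 'I_n => if (j < t)%N then comp_root a j else a j).

Definition key o a : option 'I_n * N r * N r := (o, comp_root a, proj o a).

Definition keyed o := if o is Some i then (i < t)%N else true.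

Local Notation K := (option 'I_n * N r * N r)%type.

Definition weight a : 'X_{1..#|{: K}|} :=
  (\sum_(o | keyed o) U_(enum_rank (key o a)))%MM.

Lemma eq_comp_root a b : (comp_root a == comp_root b) = connect (adj S) a b.
Proof. exact: fingraph.root_connect (@adj_connect_sym n r S) a b. Qed.

Lemma comp_root_sw i a b : (i < t)%N -> a \in S -> connect (adj S) a b ->
  comp_root (sw i a b) = comp_root a.
Proof. by move=> it aS ab; apply/esym/eqP; rewrite eq_comp_root (sw_connect swS it). Qed.

(** The roots agree, and the [i]-th coordinate is seen by the [Some i]-key alone: [None] only reads
    coordinates from [t] on, and [i < t]. *)
Lemma key_sw o i a b : (i < t)%N -> a \in S -> connect (adj S) a b ->
  key o (sw i a b) = key o (if o == Some i then b else a).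
Proof.
move=> it aS ab; rewrite /key comp_root_sw //.
have /eqP rab : comp_root a == comp_root b by rewrite eq_comp_root.
case: o => [k|] /=; last first.
  congr (_, _, _); apply/ffunP=> j; rewrite !ffunE comp_root_sw //.
  by case: ltnP => // tj; case: eqP => // ji; move: tj; rewrite ji leqNgt it.
have -> : (Some k == Some i) = (k == i) by [].
have [->|ki] := eqVneq k i; rewrite ?rab; congr (_, _, _).
  by rewrite comp_root_sw // rab; apply: eq_swr; rewrite swE eqxx.
by rewrite comp_root_sw // rab; apply: eq_swr; rewrite swE (negPf ki).
Qed.

Lemma weight_sw i a b : (i < t)%N -> a \in S -> connect (adj S) a b ->
  (weight (sw i a b) + weight (sw i b a) = weight a + weight b)%MM.
Proof.
move=> it aS ab; have bS := connect_mem aS ab.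
have ba : connect (adj S) b a by rewrite adj_connect_sym.
rewrite /weight -!big_split /=; apply: eq_bigr => o _.
by rewrite !key_sw //; case: eqP => // _; rewrite addmC.
Qed.

(** The exponent is 0 or 1 because the tag [o] inside a key keeps the variables of different factors
    apart. *)
Lemma weight_key o a c : keyed o ->
  weight c (enum_rank (key o a)) = (key o c == key o a).
Proof.
move=> ko; rewrite /weight mnm_sumE (bigD1 o) //= big1 ?addn0.
  by rewrite mnm1E (inj_eq enum_rank_inj).
move=> o' /andP[_ oo']; rewrite mnm1E (inj_eq enum_rank_inj).
by case: eqP => // -[e]; rewrite e eqxx in oo'.
Qed.

(** The variable named by [key o a] has positive exponent on the left, so some entry of [s'] must
    contribute it too. *)
Lemma key_mem o a s s' : keyed o -> a \in s ->
  (\sum_(c <- s) weight c = \sum_(c <- s') weight c)%MM ->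
  exists2 c, c \in s' & key o c = key o a.
Proof.
move=> ko a_s /mnmP/(_ (enum_rank (key o a))); rewrite !mnm_sumE.
rewrite (big_rem a) //= weight_key // eqxx => ess'.
have [/hasP[c cs' /eqP e]|/hasPn no] := boolP (has (fun c => key o c == key o a) s').
  by exists c.
suff e0 : \sum_(c <- s') weight c (enum_rank (key o a)) = 0%N by rewrite e0 in ess'.
by rewrite big_seq big1 // => c /no /negPf cs'; rewrite weight_key // cs'.
Qed.

Definition monom s : PR r F := \prod_(c <- s) xv c.

Lemma perm_monom s s' : perm_eq s s' -> monom s = monom s'.
Proof. exact: perm_big. Qed.

Lemma perm_weight s s' : perm_eq s s' ->
  (\sum_(c <- s) weight c = \sum_(c <- s') weight c)%MM.
Proof. exact: perm_big. Qed.

Lemma key_None_eq a b j : key None a = key None b -> (t <= j)%N -> a j = b j.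
Proof.
by move=> /(congr1 snd)/ffunP/(_ j) /=; rewrite !ffunE => + tj; rewrite ltnNge tj.
Qed.

Lemma key_Some_eq i a b : key (Some i) a = key (Some i) b -> a i = b i.
Proof. by move=> /(congr1 snd)/ffunP/(_ i) /=; rewrite !swE eqxx. Qed.

Lemma key_root_eq o a b : key o a = key o b -> comp_root a = comp_root b.
Proof. by case. Qed.

(* The coordinates below [t] of a factor are corrected one at a time: a factor
   sharing its [Some i]-key with [a] lies in the component of [a], so switching
   the [i]-th coordinate with it changes the monomial by a generator of [PS]. *)
Lemma monom_approx a s s' (k : nat) : all (mem S) s' ->
  (\sum_(c <- a :: s) weight c = \sum_(c <- s') weight c)%MM -> (k <= t)%N ->
  exists b u, [/\ all (mem S) (b :: u),
    (\sum_(c <- b :: u) weight c = \sum_(c <- s') weight c)%MM,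
    PS (monom s' - monom (b :: u)), comp_root b = comp_root a &
    forall j, (j < k)%N || (t <= j)%N -> b j = a j].
Proof.
move=> s'S es'; elim: k => [|k IH] kt.
  have [b bs' kb] := @key_mem None a _ _ isT (mem_head a s) es'.
  have pb := perm_to_rem bs'.
  exists b, (rem b s'); rewrite -(perm_all _ pb); split=> //.
  - by apply: perm_weight; rewrite perm_sym.
  - by rewrite (perm_monom pb) subrr; apply: ideal0 PS_is_ideal.
  - exact: key_root_eq kb.
  - by move=> j /= tj; apply: key_None_eq kb tj.
have [b [u [buS wbu Pbu rb eb]]] := IH (ltnW kt).
(* [t] may exceed [n] here; from [k = n] on, every coordinate is already corrected. *)
have [nk|kn] := leqP n k.
  exists b, u; split=> // j _; apply: eb.
  by rewrite (leq_trans (ltn_ord j) nk).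
pose i := Ordinal kn; have it : (i < t)%N by [].
have [c cbu kc] :=
  @key_mem (Some i) a _ _ it (mem_head a s) (etrans es' (esym wbu)).
have ci := key_Some_eq kc; have rc := key_root_eq kc.
have fin b' : (forall j, b' j = if j == i then c j else b j) ->
    forall j, (j < k.+1)%N || (t <= j)%N -> b' j = a j.
  move=> eb' j; rewrite eb' ltnS leq_eqVlt -orbA.
  have [-> //|ji] := eqVneq j i.
  have -> /= : (j == k :> nat) = false by apply: contraNF ji => /eqP e; apply/eqP/val_inj.
  exact: eb.
(* If the factor found is [b] itself, its [i]-th coordinate is already that of [a]; otherwise it is
   an entry of [u]. *)
have [ecb|ncb] := eqVneq c b.
  exists b, u; split=> //; apply: fin => j.
  by rewrite ecb if_same.
have cu : c \in u by move: cbu; rewrite inE (negPf ncb).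
have pu := perm_to_rem cu.
move: buS => /= /andP[bS uS].
have cS : c \in S by move/allP: uS; apply.
have bc : connect (adj S) b c by rewrite -eq_comp_root rb rc.
have cb : connect (adj S) c b by rewrite adj_connect_sym.
exists (sw i b c), (sw i c b :: rem c u); split.
- rewrite /= !(sw_mem swS it) //=; apply/allP=> x /mem_rem; exact: (allP uS).
- by rewrite !big_cons addmA weight_sw // -addmA -wbu !big_cons
    (perm_weight pu) big_cons.
- apply: (ideal_congr_trans PS_is_ideal Pbu).
  rewrite /monom !big_cons (perm_big _ pu) big_cons !mulrA -mulrBl mulrC.
  exact: (idealMl PS_is_ideal) (PS_fpol it bS bc).
- by rewrite comp_root_sw.
- by apply: fin => j; rewrite swE.
Qed.

(** Monomials with the same Segre image are congruent: rewrite [s'] modulo [PS] until its head is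
    [a], cancel [weight a], and recurse on the tails. *)
Lemma monom_congr s s' : all (mem S) s -> all (mem S) s' ->
  (\sum_(c <- s) weight c = \sum_(c <- s') weight c)%MM ->
  PS (monom s - monom s').
Proof.
elim: s s' => [|a s IH] [|a' s'] aS a'S ess'.
- by rewrite subrr; apply: ideal0 PS_is_ideal.
(* A nonempty list has nonzero weight, since each entry has a [None]-key. *)
- by have [] := @key_mem None a' _ [::] isT (mem_head a' s') (esym ess').
- by have [] := @key_mem None a _ [::] isT (mem_head a s) ess'.
have [b [u [buS wbu Pbu _ eb]]] := monom_approx a'S ess' (leqnn t).
have e : b = a by apply/ffunP=> j; apply: eb; rewrite orbC leqNgt orNb.
rewrite {b}e in buS wbu Pbu {eb}.
suff Psu : PS (monom s - monom u).
  apply: (ideal_congr_trans PS_is_ideal _ (idealBC PS_is_ideal Pbu)).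
  by rewrite /monom !big_cons; apply: (ideal_congr_mull PS_is_ideal).
apply: IH.
- by case/andP: aS.
- by case/andP: buS.
- by move: ess'; rewrite -wbu !big_cons; apply: addmI.
Qed.

Definition segre_coord (x : 'I_#|{: N r}|) : {mpoly F[#|{: K}|]} :=
  if enum_val x \in S then 'X_[weight (enum_val x)] else 0.

Definition segre : {rmorphism PR r F -> {mpoly F[#|{: K}|]}} :=
  mmap (@mpolyC #|{: K}| F) segre_coord.

Lemma segre_xv a : segre (xv a) = if a \in S then 'X_[weight a] else 0.
Proof. by rewrite /= mmapX mmap1U /segre_coord enum_rankK. Qed.

Lemma segreZ (x : F) p : segre (x *: p) = x *: segre p.
Proof. by rewrite /= mmapZ mul_mpolyC. Qed.

Lemma segre_monom s : segre (monom s) =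
  if all (mem S) s then 'X_[(\sum_(c <- s) weight c)%MM] else 0.
Proof.
elim: s => [|a s IH].
  by rewrite /monom !big_nil rmorph1 mpolyX0.
rewrite /monom !big_cons rmorphM segre_xv -/(monom s) IH mpolyXD /=.
by case: (a \in S) => /=; rewrite ?mul0r //; case: ifP => _; rewrite ?mulr0.
Qed.

Lemma segre_fpol i a b : (i < t)%N -> a \in S -> connect (adj S) a b ->
  segre (fpol i a b) = 0.
Proof.
move=> it aS ab; have bS := connect_mem aS ab.
have ba : connect (adj S) b a by rewrite adj_connect_sym.
rewrite rmorphB !rmorphM !segre_xv !(sw_mem swS it) // aS bS.
by rewrite -!mpolyXD weight_sw // subrr.
Qed.

(** The generators involve all pairs at distance 2. A pair in [S] with [a i != b i] is connected;
    for any other pair with [a i != b i], both monomials are sent to 0. *)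
Lemma segre_Igen : subideal (@Igen n r F t) (fun f => segre f = 0).
Proof.
have [idK _ _] := ker_prime_ideal segre.
move=> f If; apply: (If _ idK) => _ [i [a [b [ab2 [it ->]]]]].
have [abi|abi] := eqVneq (a i) (b i).
  by rewrite /fpol !sw_eql // subrr rmorph0.
have swm c d : c \in S -> d \in S -> dist c d = 2%N -> sw i c d \in S.
  by move=> cS dS cd2; apply: swS.
have [/andP[aS bS]|abS] := boolP ((a \in S) && (b \in S)).
  by apply: segre_fpol => //; apply: (dist2_connect swS it).
rewrite rmorphB !rmorphM !segre_xv.
have [/andP[aS bS]|] := boolP ((sw i a b \in S) && (sw i b a \in S)).
  (* Switching the switched pair again recovers [a] and [b], which would then both lie in [S]. *)
  have := swm _ _ aS bS; have := swm _ _ bS aS.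
  rewrite !sw_swl !sw_swr !sw_id distC dist_sw_sw => /(_ ab2) bS' /(_ ab2) aS'.
  by rewrite aS' bS' in abS.
rewrite !negb_and in abS * => /orP[] /negPf ->; case/orP: abS => /negPf ->;
  by rewrite ?mul0r ?mulr0 subrr.
Qed.

Lemma monomP (m : 'X_{1..#|{: N r}|}) : exists s, 'X_[m] = monom s.
Proof.
rewrite mpolyXE_id; elim/big_ind: _ => [|x y [s ->] [s' ->]|x _].
- by exists [::]; rewrite /monom big_nil.
- by exists (s ++ s'); rewrite /monom big_cat.
- exists (nseq (m x) (enum_val x)); rewrite /monom big_nseq.
  by rewrite /Defs.xv enum_valK iter_mulr_1.
Qed.

Variant segre_spec (m : 'X_{1..#|{: N r}|}) : {mpoly F[#|{: K}|]} -> Prop :=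
| SegreZero of PS 'X_[m] : segre_spec m 0
| SegreMonom s of all (mem S) s & 'X_[m] = monom s :
    segre_spec m 'X_[(\sum_(c <- s) weight c)%MM].

Lemma segreP m : segre_spec m (segre 'X_[m]).
Proof.
have [s es] := monomP m; rewrite es segre_monom.
have [sS|/allPn[c cs cS]] := boolP (all (mem S) s); first exact: SegreMonom.
apply: SegreZero; rewrite es /monom (big_rem c) //= mulrC.
exact: idealMl PS_is_ideal _ _ (PS_var cS).
Qed.

(** Group the terms of [f] by the Segre image of their monomials. A group with image 0 lies in [PS]
    termwise; in any other group the coefficients sum to 0, so it is a combination of differences of
    congruent monomials. *)
Lemma segre_ker f : segre f = 0 -> PS f.
Proof.
move=> f0; rewrite (mpolyE f) (sum_by_value (fun m => segre 'X_[m])).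
have idP := PS_is_ideal.
apply: ideal_sum => // v; rewrite mem_undup => /mapP[m0 _ ->] _.
case: segreP => [_|s0 s0S em0].
  apply: ideal_sum => // m _; case: segreP => [Pm _|s _ _].
    by rewrite -mul_mpolyC; apply: (idealMl idP).
  by rewrite mpolyX_eq0.
set w := (\sum_(c <- s0) weight c)%MM.
(* This sum is the coefficient of ['X_[w]] in [segre f]. *)
have coef0 : \sum_(m <- msupp f | segre 'X_[m] == 'X_[w]) f@_m = 0.
  transitivity (segre f)@_w; last by rewrite f0 mcoeff0.
  rewrite {3}(mpolyE f) rmorph_sum raddf_sum big_mkcond.
  apply: eq_bigr => m _; rewrite segreZ [RHS]mcoeffZ.
  case: segreP => [_|s _ _]; rewrite ?mcoeff0 ?mcoeffX.
    by rewrite eq_sym mpolyX_eq0 mulr0.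
  by rewrite (can_eq (@mleadXm _ _)); case: eqP => _; rewrite ?mulr1 ?mulr0.
have -> : \sum_(m <- msupp f | segre 'X_[m] == 'X_[w]) f@_m *: 'X_[m] =
   \sum_(m <- msupp f | segre 'X_[m] == 'X_[w]) f@_m *: ('X_[m] - 'X_[m0]).
  under [RHS]eq_bigr do rewrite scalerBr.
  by rewrite sumrB -scaler_suml coef0 scale0r subr0.
apply: ideal_sum => // m _; rewrite -mul_mpolyC => /eqP em; apply: (idealMl idP).
move: em; case: segreP => [_ /eqP|s sS -> ew]; first by rewrite eq_sym mpolyX_eq0.
rewrite em0; apply: monom_congr => //.
by apply: (can_inj (@mleadXm _ F)); rewrite ew.
Qed.

Lemma PS_eq_ker f : PS f <-> segre f = 0.
Proof.
split; last exact: segre_ker.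
have [idK _ _] := ker_prime_ideal segre.
apply: (PS_sub idK) f => [a aS|i a b it aS ab]; last exact: segre_fpol.
by rewrite segre_xv (negPf aS).
Qed.

Lemma PS_prime : is_prime_ideal PS.
Proof.
have [_ n1 KM] := ker_prime_ideal segre.
split; first exact: PS_is_ideal.
  by rewrite PS_eq_ker.
by move=> a b; rewrite !PS_eq_ker; apply: KM.
Qed.

Lemma Igen_sub_PS : subideal (@Igen n r F t) PS.
Proof. by move=> f If; rewrite PS_eq_ker; apply: segre_Igen. Qed.

Lemma PS_xvE a : PS (xv a) <-> a \notin S.
Proof.
rewrite PS_eq_ker segre_xv; case: ifP => // _; split=> // /eqP.
by rewrite mpolyX_eq0.
Qed.
End Toric.

(** * Primes containing the switching ideal *)

Section PrimeOverI.
Variables (n : nat) (r : 'I_n -> nat) (F : fieldType) (t : nat).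
Variables (P : PR r F -> Prop) (S : {set N r}).
Implicit Types (a b c d : N r) (i j : 'I_n).
Hypotheses (prP : is_prime_ideal P) (IP : subideal (@Igen n r F t) P).
Hypothesis memS : forall a, a \in S <-> ~ P (xv F a).

Let idP : is_ideal P. Proof. by case: prP. Qed.

Lemma prime_notin_mul x y : ~ P x -> ~ P y -> ~ P (x * y).
Proof. by case: prP => _ _ PM nx ny /PM[]. Qed.

Lemma prime_fpol_dist2 i a b : (i < t)%N -> dist a b = 2%N -> P (fpol F i a b).
Proof. by move=> it ab2; apply: IP; apply: mem_ideal_gen; exists i, a, b. Qed.

(** If the variable of [sw i a b] were in [P], the distance 2 relation would put [xv a * xv b] in
    [P], against primality. *)
Lemma prime_switchable : switchable t S.
Proof.
move=> a b /memS aS /memS bS ab2 i it; apply/memS => Ps.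
apply: (prime_notin_mul aS bS).
rewrite -[_ * _](subrK (xv F (sw i a b) * xv F (sw i b a))); apply: idealD => //.
  exact: prime_fpol_dist2.
by rewrite mulrC; apply: idealMl.
Qed.

(* The rows [(x_(u, d))_u], [u] running over the values of the [i]-th
   coordinate, are pairwise proportional for neighbouring [d] by the dist 2
   relations; their entries are nonzero modulo [P], so proportionality is
   transitive along a path. *)
Lemma prime_fpol_connect i a b : (i < t)%N -> a \in S -> connect (adj S) a b ->
  P (fpol F i a b).
Proof.
move=> it aS ab; have swm := sw_mem prime_switchable it.
have bS := connect_mem aS ab.
(* Columns [c] and [d] stay fixed while the row [a] moves along the path; the claim is the case
   [c = a], [d = b]. *)
suff row_prop c d : connect (adj S) b c -> connect (adj S) b d ->
    P (xv F (sw i a c) * xv F (sw i b d) - xv F (sw i a d) * xv F (sw i b c)).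
  have := row_prop a b; rewrite !sw_id; apply=> //.
  by rewrite adj_connect_sym.
move: a aS ab; apply: adj_connect_ind => [_ bc bd|a a1 aS a1S aa1 a1b IH bc bd].
  by rewrite mulrC subrr; apply: ideal0.
have [cdi|cdi] := eqVneq (c i) (d i).
  by rewrite !(eq_swr _ cdi) subrr; apply: ideal0.
have [j eaj] := dist_le1_elim i aa1.
have {}IH := IH bc bd.
have [eqj|neqj] := eqVneq (a j) (a1 j).
  suff -> : a = a1 by [].
  by apply/ffunP=> k; have [->|/eaj] := eqVneq k j.
have [ji|ji] := eqVneq j i.
  have esw e : sw i a e = sw i a1 e.
    by apply/ffunP=> k; rewrite !swE; case: eqP => // /eqP ki; rewrite eaj ?ji.
  by rewrite !esw.
have a1c : connect (adj S) a1 c := connect_trans a1b bc.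
have a1d : connect (adj S) a1 d := connect_trans a1b bd.
have aa : connect (adj S) a a1 by apply: connect1; rewrite /adj aS a1S.
have step : P (fpol F i (sw i a c) (sw i a1 d)).
  apply: prime_fpol_dist2 => //; apply: (dist_eq2 (j := i) (k := j)).
  - by rewrite eq_sym.
  - by rewrite !swE eqxx.
  - by rewrite !swE (negPf ji).
  - by move=> l li lj; rewrite !swE (negPf li) eaj.
rewrite /fpol !sw_swl !sw_swr in step.
have nP e : connect (adj S) a1 e -> ~ P (xv F (sw i a1 e)).
  by move=> a1e; apply/memS/swm.
have [_ _ PM] := prP.
suff PXY : P ((xv F (sw i a1 c) * xv F (sw i a1 d)) *
    (xv F (sw i a c) * xv F (sw i b d) - xv F (sw i a d) * xv F (sw i b c))).
  by have [/prime_notin_mul[]|] := PM _ _ PXY; first exact: nP; first exact: nP.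
set X1 := xv F (sw i a1 c) in step IH *; set X2 := xv F (sw i a1 d) in step IH *.
set Y1 := xv F (sw i a c) in step *; set Y2 := xv F (sw i a d) in step *.
set Z1 := xv F (sw i b c) in IH *; set Z2 := xv F (sw i b d) in IH *.
(* The minor of rows [a] and [b], multiplied by the entries of row [a1], is a combination of the
   minors [a], [a1] and [a1], [b]. *)
have -> : X1 * X2 * (Y1 * Z2 - Y2 * Z1) =
  X1 * Z2 * (Y1 * X2 - Y2 * X1) + Y2 * X1 * (X1 * Z2 - X2 * Z1) by ring.
by apply: idealD => //; apply: idealMl.
Qed.

Lemma prime_PS_sub : subideal (@PS n r F t S) P.
Proof.
apply: PS_sub => // [a aS|i a b]; last exact: prime_fpol_connect.
have [//|] := classic (P (xv F a)).
by move/memS; rewrite (negPf aS).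
Qed.
End PrimeOverI.

Theorem theorem4p11 (F : fieldType) (n : nat) (r : 'I_n -> nat)
  (hr : forall i, (0 < r i)%N) (t : nat) (ht1 : (1 <= t)%N) (ht2 : (t <= n)%N)
  (P : PR r F -> Prop) :
  minimal_prime_over (@Igen n r F t) P ->
  exists S : {set N r},
    @max_switchable n r F t S /\ (forall f, P f <-> @PS n r F t S f).
Proof.
case=> prP IP minP.
(* [P] is an arbitrary predicate, so membership is made boolean by excluded middle. *)
pose S := [set a : N r | if excluded_middle_informative (P (xv F a)) then false else true].
have memS a : a \in S <-> ~ P (xv F a).
  by rewrite inE; case: excluded_middle_informative.
have swS := prime_switchable prP IP memS.
have PS_P := prime_PS_sub prP IP memS.
have P_PS := minP _ (PS_prime F swS) (Igen_sub_PS swS) PS_P.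
exists S; split; last by move=> f; split; [apply: P_PS | apply: PS_P].
split=> // T swT /properP[ST [a aT aS]].
have PT_a : ~ PS t T (xv F a) by rewrite PS_xvE // aT.
have PS_a : PS t S (xv F a) by rewrite PS_xvE.
split=> [/(_ _ PS_a) //|TS].
have TP : subideal (PS t T) P by move=> f /TS; apply: PS_P.
(* Minimality turns [PS t T] inside [P] into equality, so [xv a], which is in [P], would be in
   [PS t T]. *)
apply: PT_a; apply: (minP _ (PS_prime F swT) (Igen_sub_PS swT) TP).
exact: PS_P.
Qed.
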